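(* Let $n\geq3$ and let $\rho_{A_1A_2A_3}$ be a state on $H_{A_1}\otimes H_{A_2}\otimes H_{A_3}$ with $\dim H_{A_1}=\dim H_{A_2}=2$, $\dim H_{A_3}=2^{n-2}$. Let $k\geq 1$, $0<q\leq 1$, $0<s\leq 1$, $\beta\geq s$. (1) If $\mathcal N_a^s(\rho_{A_1A_3})\geq k\,\mathcal N_a^s(\rho_{A_1A_2})$, then $$\mathcal N_a^\beta(\rho_{A_1|A_2A_3})\leq q^{\beta/s}\mathcal N_a^\beta(\rho_{A_1A_2})+\frac{(1+k)^{\beta/s}-q^{\beta/s}}{k^{\beta/s}}\mathcal N_a^\beta(\rho_{A_1A_3}).$$ (2) If $\mathcal N_a^s(\rho_{A_1A_2})\geq k\,\mathcal N_a^s(\rho_{A_1A_3})$, then $$\mathcal N_a^\beta(\rho_{A_1|A_2A_3})\leq q^{\beta/s}\mathcal N_a^\beta(\rho_{A_1A_3})+\frac{(1+k)^{\beta/s}-q^{\beta/s}}{k^{\beta/s}}\mathcal N_a^\beta(\rho_{A_1A_2}).$$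
   Context: For a bipartite pure state $|\varphi\rangle_{XY}$, its negativity is $\mathcal N(|\varphi\rangle)=\|(|\varphi\rangle\langle\varphi|)^{T_X}\|_{tr}-1$, where $T_X$ is the partial transpose with respect to $X$ and $\|\cdot\|_{tr}$ is the trace norm (sum of singular values); equivalently $\mathcal N(|\varphi\rangle)=(\mathrm{tr}\sqrt{\rho_X})^2-1$ with $\rho_X=\mathrm{tr}_Y|\varphi\rangle\langle\varphi|$. The (convex-roof extended) negativity of assistance of a bipartite state $\rho_{XY}$ is $\mathcal N_a(\rho_{XY})=\max\sum_ip_i\mathcal N(|\varphi_i\rangle)$, the maximum over all pure-state ensembles $\{p_i,|\varphi_i\rangle\}$ with $\rho_{XY}=\sum_ip_i|\varphi_i\rangle\langle\varphi_i|$. $\rho_{A_1A_2},\rho_{A_1A_3}$ are reduced states, and $\rho_{A_1|A_2A_3}$ is $\rho_{A_1A_2A_3}$ viewed as a bipartite state for the cut $A_1$ versus $A_2A_3$. *)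

(* Defs.v *)
From HB Require Import structures.
From mathcomp Require Import all_boot all_order all_algebra.
From mathcomp Require Import classical_sets reals exp.
From mathcomp Require Import complex.
From mathcomp Require mxtens.
From mathcomp Require Import spectral.

Set Implicit Arguments.
Unset Strict Implicit.
Unset Printing Implicit Defensive.

Import Order.TTheory GRing.Theory Num.Theory.
Local Open Scope ring_scope.
Local Open Scope classical_set_scope.

Definition hadj (C : numClosedFieldType) (m n : nat) (A : 'M[C]_(m, n))
  : 'M[C]_(n, m) := (map_mx Num.conj A)^T.

(* tensor-product indexing: basis |i> (x) |j> of C^m (x) C^n is index i*n+j *)
Definition tidx (m n : nat) (i : 'I_m) (j : 'I_n) : 'I_(m * n) :=
  mxtens.mxtens_index (i, j).
Definition tunidx (m n : nat) (a : 'I_(m * n)) : 'I_m * 'I_n :=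
  mxtens.mxtens_unindex a.

Definition ptransX (C : numClosedFieldType) (m n : nat) (A : 'M[C]_(m * n))
  : 'M[C]_(m * n) :=
  \matrix_(a, b) A (tidx (tunidx b).1 (tunidx a).2) (tidx (tunidx a).1 (tunidx b).2).

(* trace norm = sum of the singular values = sum of the square roots of the
   eigenvalues of A^dagger A (a normal matrix, diagonalised by spectral_diag) *)
Definition tracenorm (C : numClosedFieldType) (N : nat) (A : 'M[C]_N) : C :=
  \sum_(i < N) sqrtC (spectral_diag (hadj A *m A) 0 i).

Definition is_state (C : numClosedFieldType) (N : nat) (rho : 'M[C]_N) : Prop :=
  [/\ hadj rho = rho,
      (forall v : 'cV[C]_N, 0 <= (hadj v *m rho *m v) 0 0) &
      \tr rho = 1].

(* negativity of a pure state |phi>_{XY} (phi a unit vector of C^m (x) C^n):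
   N(|phi>) = || (|phi><phi|)^{T_X} ||_tr - 1  (a real number) *)
Definition neg_pure (R : realType) (m n : nat) (phi : 'cV[R[i]]_(m * n)) : R :=
  complex.Re (tracenorm (ptransX (phi *m hadj phi))) - 1.

Definition ensemble_neg (R : realType) (m n : nat) (rho : 'M[R[i]]_(m * n))
  (x : R) : Prop :=
  exists (K : nat) (p : 'I_K -> R) (phi : 'I_K -> 'cV[R[i]]_(m * n)),
    [/\ (forall j, 0 <= p j),
        \sum_(j < K) p j = 1,
        (forall j, hadj (phi j) *m phi j = 1%:M),
        rho = \sum_(j < K) ((p j)%:C)%C *: (phi j *m hadj (phi j)) &
        x = \sum_(j < K) p j * neg_pure (phi j)].

(* (convex-roof extended) negativity of assistance of rho_{XY}:
   the maximum (= supremum, attained) over all pure-state decompositions *)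
Definition neg_assist (R : realType) (m n : nat) (rho : 'M[R[i]]_(m * n)) : R :=
  sup [set x | ensemble_neg rho x].

Definition idx3 (d1 d2 d3 : nat) (i1 : 'I_d1) (i2 : 'I_d2) (i3 : 'I_d3)
  : 'I_(d1 * (d2 * d3)) := tidx i1 (tidx i2 i3).

Definition red12 (C : numClosedFieldType) (d1 d2 d3 : nat)
  (rho : 'M[C]_(d1 * (d2 * d3))) : 'M[C]_(d1 * d2) :=
  \matrix_(a, b) \sum_(i3 < d3)
     rho (idx3 (tunidx a).1 (tunidx a).2 i3) (idx3 (tunidx b).1 (tunidx b).2 i3).

Definition red13 (C : numClosedFieldType) (d1 d2 d3 : nat)
  (rho : 'M[C]_(d1 * (d2 * d3))) : 'M[C]_(d1 * d3) :=
  \matrix_(a, b) \sum_(i2 < d2)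
     rho (idx3 (tunidx a).1 i2 (tunidx a).2) (idx3 (tunidx b).1 i2 (tunidx b).2).

(* Main.v *)
(** A pure state of C^2 (x) C^m with coefficient matrix M (rows x, y) has
    negativity 2 sqrt(det(M M^dagger)) = sqrt(2 sum_(a,b) |x_a y_b - x_b y_a|^2).
    For a pure state of C^2 (x) C^2 (x) C^d the minors x_a y_b - x_b y_a,
    a = (j,k) and b = (j',l), split orthogonally into a symmetric d x d matrix S
    and a family Q of symmetric 2 x 2 matrices indexed by (k,l): the squared
    negativity is 4 |S|^2 + 2 |Q|^2 (Frobenius norms). Measuring the third
    system in an orthonormal basis V yields a decomposition of the reduced
    state of the first two of average negativity 2 sum_k |(V S V^T)_kk|, and
    Takagi diagonalization of S makes it at least 2 |S|. Measuring the second
    system likewise yields a decomposition of the other reduced state, of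
    average negativity at least sqrt 2 |Q| in a suitable basis. Hence the
    negativity of assistance is subadditive, N_a(1|23) <= N_a(12) + N_a(13),
    first for pure states and then, mixing ensembles, for all states. The
    bounds on powers follow from the convexity of t-th powers, t >= 1. *)
Require Import Defs.
From HB Require Import structures.
From mathcomp Require Import all_boot all_order all_algebra.
From mathcomp Require Import classical_sets reals exp.
From mathcomp Require Import complex.
From mathcomp Require mxtens.
From mathcomp Require Import spectral interval_inference convex hoelder.
From mathcomp Require Import ring lra.
Import Order.TTheory GRing.Theory Num.Theory.
Local Open Scope ring_scope.

Set Implicit Arguments.
Unset Strict Implicit.
Unset Printing Implicit Defensive.

(** * Trace norm of the partial transpose of a pure state *)

Section CharPoly.
Variables (F : fieldType).

(** Sylvester's determinant identity: two block triangular multipliers, one on each side of [K],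
    make it block upper triangular with ['X%:M - a *m b] or ['X%:M - b *m a] as a diagonal block. *)
Lemma char_poly_mulmxC m n (A : 'M[F]_(m, n)) (B : 'M[F]_(n, m)) :
  'X^n * char_poly (A *m B) = 'X^m * char_poly (B *m A).
Proof.
rewrite /char_poly /char_poly_mx !map_mxM /=.
set a := map_mx _ A; set b := map_mx _ B.
pose K := block_mx ('X%:M : 'M_m) a b (1%:M : 'M_n).
have KL : \det K = \det ('X%:M - a *m b).
  have : \det (K *m block_mx 1%:M 0 (- b) 1%:M) = \det ('X%:M - a *m b).
    rewrite mulmx_block !(mulmx1, mul1mx, mulmx0, add0r, mulmxN) subrr.
    by rewrite det_ublock det1 mulr1.
  by rewrite det_mulmx det_lblock !det1 !mulr1.
have : \det (block_mx 1%:M 0 (- b) 'X%:M *m K) = 'X^m * \det ('X%:M - b *m a).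
  rewrite mulmx_block !(mulmx1, mul1mx, mul0mx, addr0, mulNmx) mul_mx_scalar.
  rewrite mul_scalar_mx addNr det_ublock det_scalar.
  by congr (_ * \det _); rewrite addrC.
by rewrite det_mulmx det_lblock det1 mul1r det_scalar KL.
Qed.

Lemma char_poly_simdiag n (P Q : 'M[F]_n) (d : 'rV_n) : P *m Q = 1%:M ->
  char_poly (Q *m diag_mx d *m P) = \prod_i ('X - (d 0 i)%:P).
Proof.
move=> PQ; have Xn0 : ('X^n : {poly F}) != 0 by rewrite monic_neq0 ?monicXn.
apply: (mulfI Xn0); rewrite -mulmxA char_poly_mulmxC -mulmxA PQ mulmx1.
rewrite char_poly_trig ?diag_mx_is_trig //; congr (_ * _).
by apply: eq_bigr => i _; rewrite mxE eqxx.
Qed.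

End CharPoly.

(** * Indices of a tensor product *)

Lemma tidxK m n (i : 'I_m) (j : 'I_n) : tunidx (tidx i j) = (i, j).
Proof. exact: mxtens.mxtens_indexK. Qed.

Lemma tunidxK m n (a : 'I_(m * n)) : tidx (tunidx a).1 (tunidx a).2 = a.
Proof. by rewrite /tidx -surjective_pairing; exact: mxtens.mxtens_unindexK. Qed.

Lemma tidx_eq m n (i k : 'I_m) (j l : 'I_n) :
  (tidx i j == tidx k l) = (i == k) && (j == l).
Proof. by rewrite (can_eq (@mxtens.mxtens_indexK _ _)) xpair_eqE. Qed.

Lemma sum_tidx (V : nmodType) m n (F : 'I_(m * n) -> V) :
  \sum_a F a = \sum_i \sum_j F (tidx i j).
Proof.
rewrite (reindex (fun p : 'I_m * 'I_n => tidx p.1 p.2)) /=.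
  by rewrite -(pair_bigA _ (fun i j => F (tidx i j))).
exists (@tunidx m n) => x _; last exact: tunidxK.
by case: x => x y; exact: tidxK.
Qed.

(** * Spectra of Gram matrices *)

Section TraceNorm.
Variable C : numClosedFieldType.
Implicit Types m n : nat.

Lemma hadjE m n (A : 'M[C]_(m, n)) i j : hadj A i j = (A j i)^*.
Proof. by rewrite !mxE. Qed.

Lemma hadjK m n (A : 'M[C]_(m, n)) : hadj (hadj A) = A.
Proof. by apply/matrixP => i j; rewrite !hadjE conjCK. Qed.

Lemma hadjM m n p (A : 'M[C]_(m, n)) (B : 'M[C]_(n, p)) :
  hadj (A *m B) = hadj B *m hadj A.
Proof. by rewrite /hadj map_mxM trmx_mul. Qed.

Lemma hadjtC m n (A : 'M[C]_(m, n)) : (map_mx Num.conj A^T) = hadj A.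
Proof. by apply/matrixP => i j; rewrite !mxE. Qed.

Lemma hermitian_spectral n (H : 'M[C]_n) : hadj H = H ->
  exists (P : 'M[C]_n), [/\ P *m hadj P = 1%:M, hadj P *m P = 1%:M &
    H = hadj P *m diag_mx (spectral_diag H) *m P].
Proof.
move=> Hh; have /orthomx_spectralP HE : H \is normalmx.
  by apply/normalmxP; rewrite hadjtC Hh.
have PP : spectralmx H *m hadj (spectralmx H) = 1%:M.
  by rewrite -hadjtC; apply/unitarymxP/spectral_unitarymx.
exists (spectralmx H); split=> //; first exact: mulmx1C.
by rewrite {1}HE invmx_unitary ?spectral_unitarymx // hadjtC.
Qed.

(** The characteristic polynomial fixes the eigenvalues up to order, and the sum ignores the order.
    Any diagonalizing similarity may thus replace the one chosen by [spectral_diag]. *)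
Lemma spectral_sum n (f : C -> C) (H P Q : 'M[C]_n) (d : 'rV_n) :
  hadj H = H -> P *m Q = 1%:M -> H = Q *m diag_mx d *m P ->
  \sum_i f (spectral_diag H 0 i) = \sum_i f (d 0 i).
Proof.
move=> Hh PQ HE; have [S [SS _ HS]] := hermitian_spectral Hh.
have := char_poly_simdiag d PQ; rewrite -HE {1}HS char_poly_simdiag //.
set e := spectral_diag H => eqP.
have {}eqP : \prod_(x <- [seq e 0 i | i <- index_enum 'I_n]) ('X - x%:P)
           = \prod_(x <- [seq d 0 i | i <- index_enum 'I_n]) ('X - x%:P).
  by rewrite !big_map.
have /prod_XsubC_eq eP := eqP.
have := perm_big _ (op := +%R) (x := 0 : C) eP (P := xpredT) (F := f).
by rewrite !big_map.
Qed.

Lemma gram_herm m n (A : 'M[C]_(m, n)) : hadj (hadj A *m A) = hadj A *m A.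
Proof. by rewrite hadjM hadjK. Qed.

Lemma gram_spectral_ge0 m n (A : 'M[C]_(m, n)) i :
  0 <= spectral_diag (hadj A *m A) 0 i.
Proof.
have [P [PP _ HE]] := hermitian_spectral (gram_herm A).
set d := spectral_diag _ in HE *.
have : P *m (hadj A *m A) *m hadj P = diag_mx d.
  by rewrite HE !mulmxA PP mul1mx -mulmxA PP mulmx1.
move/matrixP/(_ i i); rewrite [RHS]mxE eqxx mulr1n => <-.
have -> : P *m (hadj A *m A) *m hadj P = hadj (A *m hadj P) *m (A *m hadj P).
  by rewrite hadjM hadjK !mulmxA.
by rewrite mxE sumr_ge0 // => k _; rewrite hadjE mulrC -normCK exprn_ge0.
Qed.


Lemma gramr_spectral_ge0 m n (A : 'M[C]_(m, n)) i :
  0 <= spectral_diag (A *m hadj A) 0 i.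
Proof. by have := gram_spectral_ge0 (hadj A) i; rewrite hadjK. Qed.

(** The two products share their eigenvalues up to zeros, by [char_poly_mulmxC]; the padding zeros
    contribute [f 0 = 0]. *)
Lemma spectral_sum_mulmxC m n (f : C -> C) (A : 'M[C]_(m, n)) : f 0 = 0 ->
  \sum_i f (spectral_diag (A *m hadj A) 0 i)
  = \sum_i f (spectral_diag (hadj A *m A) 0 i).
Proof.
move=> f0.
have hG : hadj (A *m hadj A) = A *m hadj A by rewrite hadjM hadjK.
have [P [PP _ EG]] := hermitian_spectral hG.
have [Q [QQ _ EK]] := hermitian_spectral (gram_herm A).
have := char_poly_mulmxC A (hadj A).
rewrite {1}EG {1}EK !char_poly_simdiag //.
set d := spectral_diag _; set e := spectral_diag _ => E.
have /prod_XsubC_eq eP :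
  \prod_(x <- nseq n 0 ++ [seq d 0 i | i <- index_enum 'I_m]) ('X - x%:P)
  = \prod_(x <- nseq m 0 ++ [seq e 0 i | i <- index_enum 'I_n]) ('X - x%:P).
  rewrite !big_cat /= !big_map !big_nseq subr0.
  by rewrite !iter_mulr_1.
have := perm_big _ (op := +%R) (x := 0 : C) eP (P := xpredT) (F := f).
by rewrite !big_cat /= !big_map !big_nseq !f0 !iter_addr_0 !mul0rn !add0r.
Qed.

(** With this coefficient matrix M, the reduced state of the first factor is M M^dagger. *)
Definition vmat m n (phi : 'cV[C]_(m * n)) : 'M[C]_(m, n) :=
  \matrix_(i, j) phi (tidx i j) 0.

(** In the double sum for an entry, each summation index occurs in only two of the four factors, so
    the sum splits into a product. *)
Lemma ptransX_gram m n (phi : 'cV[C]_(m * n)) (M := vmat phi)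
    (A := ptransX (phi *m hadj phi)) :
  hadj A *m A = mxtens.tensmx (M *m hadj M)^T (hadj M *m M)^T.
Proof.
apply/matrixP => a b; rewrite mxE sum_tidx exchange_big /= /M !mxE mulr_suml.
apply: eq_bigr => j _; rewrite mulr_sumr; apply: eq_bigr => i _.
rewrite !mxE !big_ord1 !mxE !tidxK /=.
rewrite rmorphM /= conjCK.
ring.
Qed.

(** By [ptransX_gram] the squared singular values are the products [d_i * e_j] of eigenvalues of M
    M^dagger and M^dagger M. The sum of their roots factors, and both factors agree by
    [spectral_sum_mulmxC]. *)
Lemma tracenorm_pure m n (phi : 'cV[C]_(m * n)) (M := vmat phi) :
  tracenorm (ptransX (phi *m hadj phi))
  = (\sum_i sqrtC (spectral_diag (M *m hadj M) 0 i)) ^+ 2.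
Proof.
rewrite /tracenorm.
have hG : hadj (M *m hadj M) = M *m hadj M by rewrite hadjM hadjK.
have [P [PP _ EG]] := hermitian_spectral hG.
have [Q [QQ _ EK]] := hermitian_spectral (gram_herm M).
set d := spectral_diag _ in EG; set e := spectral_diag _ in EK.
pose de : 'rV[C]_(m * n) := \row_a (d 0 (tunidx a).1 * e 0 (tunidx a).2).
have tdiag : mxtens.tensmx (diag_mx d) (diag_mx e) = diag_mx de.
  apply/matrixP => a b; rewrite !mxE.
  case: (mxtens.mxtens_indexP a) => i j; case: (mxtens.mxtens_indexP b) => k l.
  rewrite -!/(tidx _ _) -!/(tunidx _) !tidxK /= tidx_eq.
  by do 2!case: eqP => _; rewrite /= ?mulr1n ?mulr0n ?mul0r ?mulr0.
have tone (p q : nat) : mxtens.tensmx (1%:M : 'M[C]_p) (1%:M : 'M[C]_q) = 1%:M.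
  apply/matrixP => a b; rewrite !mxE.
  case: (mxtens.mxtens_indexP a) => i j; case: (mxtens.mxtens_indexP b) => k l.
  rewrite -!/(tidx _ _) -!/(tunidx _) !tidxK /= tidx_eq.
  by do 2!case: eqP => _; rewrite /= ?mulr1 ?mul0r ?mulr0.
rewrite (@spectral_sum _ _ _ (mxtens.tensmx (hadj P)^T (hadj Q)^T)
   (mxtens.tensmx P^T Q^T) de).
- rewrite sum_tidx expr2.
  rewrite [X in _ = _ * X]spectral_sum_mulmxC ?sqrtC0 // mulr_suml.
  apply: eq_bigr => i _; rewrite mulr_sumr; apply: eq_bigr => j _.
  by rewrite mxE tidxK sqrtCM // nnegrE ?gramr_spectral_ge0 ?gram_spectral_ge0.
- exact: gram_herm.
- by rewrite mxtens.tensmx_mul -!trmx_mul PP QQ !trmx1 tone.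
- rewrite ptransX_gram -/M {1}EG {1}EK -tdiag !mxtens.tensmx_mul.
  by rewrite !trmx_mul !tr_diag_mx !mulmxA.
Qed.

(** With only two eigenvalues, the square of the sum of their roots is their sum plus twice the root
    of their product. *)
Lemma tracenorm_pure2 n (phi : 'cV[C]_(2 * n)) (M := vmat phi) :
  tracenorm (ptransX (phi *m hadj phi))
  = \tr (M *m hadj M) + 2 * sqrtC (\det (M *m hadj M)).
Proof.
rewrite tracenorm_pure -/M.
have hG : hadj (M *m hadj M) = M *m hadj M by rewrite hadjM hadjK.
have [P [PP PP' EG]] := hermitian_spectral hG.
set d := spectral_diag _ in EG *.
have d0 i : 0 <= d 0 i by exact: gramr_spectral_ge0.
have -> : \det (M *m hadj M) = \det (diag_mx d).
  by rewrite EG !det_mulmx mulrAC -det_mulmx PP' det1 mul1r.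
rewrite EG mxtrace_mulC mulmxA PP mul1mx mxtrace_diag det_diag.
rewrite !big_ord_recl !big_ord0 addr0 mulr1 sqrtCM ?qualifE //=.
by rewrite sqrrD !sqrtCK addrAC -mulr_natl addr0.
Qed.

End TraceNorm.

(** * Unitary congruence of symmetric matrices *)

Section Congruence.
Variable C : numClosedFieldType.
Implicit Types m n : nat.

Definition unitary n (V : 'M[C]_n) := V *m hadj V = 1%:M.

Lemma unitaryM n (V W : 'M[C]_n) : unitary V -> unitary W -> unitary (V *m W).
Proof.
by move=> hV hW; rewrite /unitary hadjM mulmxA -(mulmxA V) hW mulmx1.
Qed.

Lemma unitary_trV n (V : 'M[C]_n) : unitary V -> V^T *m hadj V^T = 1%:M.
Proof.
move=> hV; have : hadj V *m V = 1%:M by exact: mulmx1C.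
move/(congr1 (@trmx _ _ _)); rewrite trmx1 trmx_mul => <-.
by congr (_ *m _); apply/matrixP => i j; rewrite !mxE.
Qed.

Lemma mxtrace_gram m n (A : 'M[C]_(m, n)) :
  \tr (A *m hadj A) = \sum_i \sum_j `|A i j| ^+ 2.
Proof.
apply: eq_bigr => i _; rewrite mxE; apply: eq_bigr => j _.
by rewrite hadjE normCK.
Qed.

Lemma congr_gram n (V S : 'M[C]_n) : unitary V ->
  (V *m S *m V^T) *m hadj (V *m S *m V^T) = V *m (S *m hadj S) *m hadj V.
Proof.
move=> hV; rewrite !hadjM !mulmxA -(mulmxA (V *m S)) unitary_trV //.
by rewrite mulmx1.
Qed.

Lemma congr_norm n (V S : 'M[C]_n) : unitary V ->
  \sum_i \sum_j `|(V *m S *m V^T) i j| ^+ 2 = \sum_i \sum_j `|S i j| ^+ 2.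
Proof.
move=> hV; rewrite -!mxtrace_gram congr_gram // mxtrace_mulC (mulmxA (hadj V)).
by rewrite (mulmx1C hV) mul1mx.
Qed.

(* If y is an eigenvector of S S^dagger for s^2, then conj(y S) + s y is a
   coneigenvector, unless it vanishes, in which case 'i y is one. *)
Lemma exists_coneigenvector n (S : 'M[C]_n) : (0 < n)%N -> S^T = S ->
  exists (x : 'rV[C]_n) (c : C), x != 0 /\ x *m S = c *: map_mx Num.conj x.
Proof.
move=> n0 symS; have [a /eigenvalueP[y yH y0]] := eigenvalue_closed (S *m hadj S) n0.
have hS : hadj S = map_mx Num.conj S by rewrite -hadjtC symS.
have cc h k (z : 'M[C]_(h, k)) : map_mx Num.conj (map_mx Num.conj z) = z.
  by apply/matrixP => i j; rewrite !mxE conjCK.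
(* Compare squared norms: |y S|^2 = a |y|^2. Hence [sqrtC a] is real and commutes with
   conjugation. *)
have a0 : 0 <= a.
  have Ey : \tr (y *m S *m hadj (y *m S)) = a * \tr (y *m hadj y).
    by rewrite hadjM mulmxA -(mulmxA y) yH -scalemxAl mxtraceZ.
  have y1 : 0 < \tr (y *m hadj y).
    rewrite mxtrace_gram big_ord1 lt0r sumr_ge0 ?andbT; last first.
      by move=> i _; rewrite exprn_ge0.
    apply: contra y0 => /eqP y0; apply/eqP/matrixP => i j; rewrite ord1 mxE.
    apply/eqP; rewrite -normr_eq0 -sqrf_eq0.
    by have /psumr_eq0P -> := y0 => // k _; rewrite exprn_ge0.
  rewrite -(pmulr_lge0 _ y1) -Ey mxtrace_gram sumr_ge0 // => i _.
  by rewrite sumr_ge0 // => j _; rewrite exprn_ge0.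
have s0 : (sqrtC a)^* = sqrtC a by apply/CrealP; rewrite ger0_real ?sqrtC_ge0.
pose x := map_mx Num.conj (y *m S) + sqrtC a *: y.
have [x0|x0] := eqVneq x 0; last first.
  exists x, (sqrtC a); split=> //.
  rewrite mulmxDl -scalemxAl map_mxM -mulmxA.
  have -> : map_mx Num.conj S *m S = map_mx Num.conj (S *m hadj S).
    by rewrite hS map_mxM; congr (_ *m _); exact/esym/cc.
  rewrite -map_mxM yH !map_mxD cc !map_mxZ /= s0 scalerDr scalerA -expr2 sqrtCK.
  by rewrite (CrealP (ger0_real a0)) addrC.
exists ('i *: y), (sqrtC a); split.
  by rewrite scaler_eq0 (negPf y0) orbF neq0Ci.
rewrite -scalemxAl map_mxZ /= conjCi.
(* Here y S = - s conj(y); the factor 'i absorbs the sign, as its conjugate is - 'i. *)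
have -> : y *m S = - (sqrtC a *: map_mx Num.conj y).
  move/eqP: x0; rewrite addr_eq0 => /eqP/(congr1 (map_mx Num.conj)).
  by rewrite cc map_mxN map_mxZ /= s0.
by rewrite scalerN !scalerA mulrN scaleNr mulrC.
Qed.

(** Gram-Schmidt returns a unitary matrix even from dependent rows, so it is applied to the matrix
    all of whose rows are [x]. *)
Lemma unitary_row0 n (x : 'rV[C]_n.+1) : x != 0 ->
  exists (V : 'M[C]_n.+1) (c : C), unitary V /\ row 0 V = c *: x.
Proof.
move=> x0; pose A : 'M[C]_n.+1 := \matrix_(i, j) x 0 j.
have Ax : row 0 A = x by apply/rowP => j; rewrite !mxE.
exists (schmidt A).
have uA : schmidt A \is unitarymx by rewrite schmidt_unitarymx.
have : (row 0 A <= row 0 (schmidt A))%MS.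
  have := row_schmidt_sub A 0.
  by rewrite (big_pred1 0) ?genmxE // => k /=; rewrite leqn0.
rewrite Ax => /sub_rVP[c xE]; exists c^-1; split.
  by rewrite /unitary -hadjtC; apply/unitarymxP.
have c0 : c != 0 by apply: contraNneq x0 => c0; rewrite xE c0 scale0r.
by rewrite xE scalerA mulVf // scale1r.
Qed.

(** Deflation: in a unitary basis starting with a coneigenvector, the first row of the congruent
    matrix vanishes off the diagonal. By symmetry so does the first column, and induction treats the
    remaining block. *)
Lemma takagi n (S : 'M[C]_n) : S^T = S ->
  exists (V : 'M[C]_n) (d : 'rV_n), unitary V /\ V *m S *m V^T = diag_mx d.
Proof.
elim: n S => [|n IH] S symS.
  exists 1%:M, 0; split; first by apply/matrixP; case.
  by apply/matrixP; case.
have [x [c [x0 xS]]] := exists_coneigenvector (ltn0Sn n) symS.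
have [B [b [uB rB]]] := unitary_row0 x0.
have [T TE] : exists T : 'M[C]_(1 + n), T = B *m S *m B^T by exists (B *m S *m B^T).
have symT : T^T = T by rewrite TE !trmx_mul trmxK symS mulmxA.
have [e rT] : exists e, row 0 T = e *: row 0 1%:M.
  have b0 : b != 0.
    apply/eqP => b0; move/matrixP/(_ 0 0): uB; rewrite !mxE eqxx.
    rewrite big1 => [|j _]; first by move/esym/eqP; rewrite oner_eq0.
    by move/rowP/(_ j): rB; rewrite b0 scale0r !mxE => ->; rewrite mul0r.
  (* The first row of B is b x, and b x S = b c conj(x) = (b c / conj b) conj(b x). *)
  exists (b * c / b^*).
  have -> : row 0 (1%:M : 'M[C]_(1 + n)) = map_mx Num.conj (row 0 B) *m B^T.
    rewrite -[B^T in RHS](_ : map_mx Num.conj (hadj B) = _); last first.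
      by apply/matrixP => i j; rewrite !mxE conjCK.
    by rewrite -map_mxM -row_mul uB; apply/rowP => j; rewrite !mxE /= conjC_nat.
  rewrite TE !row_mul rB -!scalemxAl xS map_mxZ /= -!scalemxAl !scalerA.
  by rewrite mulfVK ?conjC_eq0.
have T0 j : T 0 (rshift 1 j) = 0.
  by move/rowP/(_ (rshift 1 j)): rT; rewrite !mxE => ->; rewrite mulr0.
have ET : T = block_mx e%:M 0 0 (drsubmx T).
  rewrite -[LHS]submxK; congr block_mx; apply/matrixP => i j; rewrite !mxE !ord1.
  - by move/rowP/(_ 0): rT; rewrite !mxE eqxx mulr1 mulr1n => <-; congr (T _ _); apply/val_inj.
  - by rewrite -(T0 j); congr (T _ _); apply/val_inj.
  - by rewrite -symT mxE -(T0 i); congr (T _ _); apply/val_inj.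
have [|V' [d [uV' VT]]] := IH (drsubmx T).
  by rewrite trmx_drsub symT.
pose W : 'M[C]_(1 + n) := block_mx 1%:M 0 0 V'.
exists (W *m B), (row_mx (e%:M : 'M_1) d); split.
  apply: unitaryM => //; change (W *m hadj W = 1%:M).
  rewrite /W /hadj map_block_mx tr_block_mx.
  rewrite !map_mx0 !trmx0 map_mx1 trmx1 mulmx_block.
  rewrite !mulmx0 !mul0mx !addr0 !add0r mulmx1 -/(hadj _) uV'.
  by rewrite -scalar_mx_block.
have -> : W *m B *m S *m (W *m B)^T = W *m T *m W^T.
  by rewrite TE trmx_mul !mulmxA.
rewrite {1}ET /W tr_block_mx.
rewrite !trmx0 !trmx1 !mulmx_block !mulmx0 !mul0mx !addr0 !add0r !mulmx1 !mul1mx.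
rewrite VT.
refine (etrans _ (esym (diag_mx_row (e%:M : 'M_1) d))); congr block_mx; last by rewrite mul0mx.
by apply/matrixP=> i j; rewrite !mxE !ord1 eqxx.
Qed.

Lemma sum_sqr_le (I : finType) (F : I -> C) : (forall i, 0 <= F i) ->
  \sum_i F i ^+ 2 <= (\sum_i F i) ^+ 2.
Proof.
move=> F0; rewrite expr2 mulr_suml ler_sum // => i _.
rewrite expr2 ler_wpM2l // (bigD1 i) //= lerDl sumr_ge0 // => j _; exact: F0.
Qed.

(** In the Takagi basis the Frobenius norm is the l2 norm of the diagonal, which its l1 norm
    dominates. *)
Lemma takagi_norm n (S : 'M[C]_n) : S^T = S ->
  exists V : 'M[C]_n, unitary V /\
    \sum_i \sum_j `|S i j| ^+ 2 <= (\sum_i `|(V *m S *m V^T) i i|) ^+ 2.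
Proof.
move=> /takagi[V [d [uV VS]]]; exists V; split=> //.
rewrite -(congr_norm S uV) VS; apply: le_trans (sum_sqr_le _) => //.
rewrite le_eqVlt; apply/orP; left; apply/eqP; apply: eq_bigr => i _.
rewrite (bigD1 i) //= big1 ?addr0 // => j ji.
by rewrite mxE eq_sym (negPf ji) mulr0n normr0 expr0n.
Qed.


Lemma sum_normsqrD (I : finType) (F G : I -> C) :
  \sum_v F v * (G v)^* + (\sum_v F v * (G v)^*)^* = 0 ->
  \sum_v `|F v + G v| ^+ 2 = \sum_v `|F v| ^+ 2 + \sum_v `|G v| ^+ 2.
Proof.
move=> FG0; apply: etrans (addr0 _); rewrite -[X in _ + X]FG0.
rewrite rmorph_sum -!big_split /=.
apply: eq_bigr => v _; rewrite !normCK !rmorphD !rmorphM /= conjCK; ring.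
Qed.

(** The rows are (1, z)/sqrt 2 and (1, -z)/sqrt 2. *)
Definition hadamard_mx (z : C) : 'M[C]_2 := \matrix_(i < 2, j < 2)
  (if j == 0 then (sqrtC 2)^-1
   else if i == 0 then z / sqrtC 2 else - z / sqrtC 2).

Lemma unitary_hadamard_mx (z : C) : `|z| = 1 -> unitary (hadamard_mx z).
Proof.
move=> z1; have s2 : (sqrtC 2 : C)^-1 * (sqrtC 2)^-1^* = 2^-1.
  rewrite -normCK normfV exprVn ger0_norm ?sqrtC_ge0 ?ler0n //.
  by rewrite sqrtCK.
have zz : z * z^* = 1 by rewrite -normCK z1 expr1n.
have h2 : 2^-1 + 2^-1 = 1 :> C by field.
have E (a b : C) : (a / sqrtC 2) * (b / sqrtC 2)^* = a * b^* / 2.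
  by rewrite rmorphM mulrACA s2.
apply/matrixP => i j; rewrite !mxE !big_ord_recl big_ord0 !mxE /= s2.
case: i => [[|[|[]]] // ?]; case: j => [[|[|[]]] // ?] /=;
  by rewrite E ?rmorphN /= ?(mulNr, mulrN) ?opprK zz ?mul1r ?mulN1r ?addr0 ?h2 ?subrr.
Qed.

(* First diagonalize sum_v Q_v Q_v^dagger. In that basis the vectors
   (1, e)/sqrt 2 and (1, -e)/sqrt 2, |e| = 1, have the same image norm A e under
   Q, and A 1 + A 'i is large enough for e = 1 or e = 'i to work. *)
Lemma unitary2_norm (I : finType) (Q : I -> 'M[C]_2) :
  (forall v, (Q v)^T = Q v) ->
  exists V : 'M[C]_2, unitary V /\
    \sum_v \sum_i \sum_j `|Q v i j| ^+ 2
    <= (\sum_i sqrtC (\sum_v `|(V *m Q v *m V^T) i i| ^+ 2)) ^+ 2.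
Proof.
move=> symQ; pose B := \sum_v Q v *m hadj (Q v).
have hB : hadj B = B.
  apply/matrixP => i j; rewrite hadjE /B !summxE rmorph_sum /=.
  by apply: eq_bigr => v _; rewrite -hadjE hadjM hadjK.
have [P [uP _ BE]] := hermitian_spectral hB.
have [Q' Q'E] : exists Q', forall v, Q' v = P *m Q v *m P^T.
  by exists (fun v => P *m Q v *m P^T).
have symQ' v : (Q' v)^T = Q' v by rewrite Q'E !trmx_mul trmxK symQ mulmxA.
have ba v : Q' v 1 0 = Q' v 0 1 by rewrite -[in LHS]symQ' mxE.
(* This is the off-diagonal entry of P B P^dagger, which is diagonal by the choice of P. *)
have Q'01 : \sum_v (Q' v 0 0 * (Q' v 0 1)^* + Q' v 0 1 * (Q' v 1 1)^*) = 0.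
  have : (\sum_v Q' v *m hadj (Q' v)) 0 1 = 0.
    have -> : \sum_v Q' v *m hadj (Q' v) = P *m B *m hadj P.
      rewrite /B mulmx_sumr mulmx_suml; apply: eq_bigr => v _.
      by rewrite Q'E congr_gram.
    by rewrite BE !mulmxA uP mul1mx -mulmxA uP mulmx1 mxE.
  rewrite summxE => Z0; rewrite -[RHS]Z0; apply: eq_bigr => v _.
  rewrite mxE !big_ord_recl big_ord0 !hadjE addr0.
  rewrite (_ : lift 0 0 = 1) ; last exact/val_inj.
  by rewrite ba.
set z := \sum_v _ in Q'01.
pose al v := Q' v 0 0; pose be v := Q' v 0 1; pose ga v := Q' v 1 1.
pose F := \sum_v (`|al v| ^+ 2 + `|ga v| ^+ 2 + 2 * `|be v| ^+ 2).
have FE : \sum_v \sum_i \sum_j `|Q v i j| ^+ 2 = F.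
  apply: eq_bigr => v _; rewrite -(congr_norm (Q v) uP) -Q'E.
  rewrite !big_ord_recl !big_ord0 !addr0.
  rewrite (_ : lift 0 0 = 1) ; last exact/val_inj.
  rewrite ba -/(al v) -/(be v) -/(ga v); ring.
pose A (e : C) := \sum_v `|(al v + e ^+ 2 * ga v) / 2| ^+ 2 + \sum_v `|be v| ^+ 2.
have A0 e : 0 <= A e.
  by rewrite addr_ge0 // sumr_ge0 // => v _; rewrite exprn_ge0.
(* Both diagonal norms equal [sqrtC (A e)], as the cross term [z0] reduces to Q'01; the square of
   their sum is 4 A e. *)
have main e : `|e| = 1 -> F <= 4 * A e ->
  exists V, unitary V /\ F
    <= (\sum_i sqrtC (\sum_v `|(V *m Q v *m V^T) i i| ^+ 2)) ^+ 2.
  move=> e1 FA.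
  have z0 : \sum_v (al v + e ^+ 2 * ga v) / 2 * (e * be v)^*
      + (\sum_v (al v + e ^+ 2 * ga v) / 2 * (e * be v)^*)^* = 0.
    have e0 : e != 0 by rewrite -normr_eq0 e1 oner_eq0.
    have ec : e^* = e^-1.
      by apply: (mulfI e0); rewrite -normCK e1 expr1n mulfV.
    transitivity (2^-1 * (e^-1 * z + e * z^*)); last first.
      by rewrite Q'01 rmorph0 !mulr0 addr0 mulr0.
    rewrite /z !rmorph_sum !mulr_sumr -!big_split mulr_sumr /=.
    apply: eq_bigr => v _; rewrite !(rmorphD, rmorphM, rmorphXn, fmorphV) /=.
    rewrite !conjCK !rmorph1 ec -/(al v) -/(be v) -/(ga v).
    by field; rewrite e0 ?pnatr_eq0.
  have [W WE uW] : exists2 W, W = hadamard_mx e & unitary W.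
    by exists (hadamard_mx e) => //; exact: unitary_hadamard_mx.
  exists (W *m P); split; first exact: unitaryM.
  have r2 : (sqrtC 2 : C) ^- 1 ^+ 2 = 2^-1 by rewrite expr1 exprVn sqrtCK.
  have VE v i : (W *m P *m Q v *m (W *m P)^T) i i
      = (al v + e ^+ 2 * ga v) / 2 + (if i == 0 then 1 else -1) * (e * be v).
    have -> : W *m P *m Q v *m (W *m P)^T = W *m Q' v *m W^T.
      by rewrite Q'E trmx_mul !mulmxA.
    rewrite !mxE !big_ord_recl !big_ord0 !mxE !big_ord_recl !big_ord0 !addr0.
    rewrite WE !mxE /= (_ : lift 0 0 = 1); last exact/val_inj.
    rewrite ba -/(al v) -/(be v) -/(ga v) -r2.
    have -> : e * be v = (sqrtC 2 : C) ^- 1 ^+ 2 * (e * be v * 2).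
      by rewrite r2; field.
    by case: ifP => _; ring.
  have AE i : \sum_v `|(W *m P *m Q v *m (W *m P)^T) i i| ^+ 2 = A e.
    under eq_bigr => v _ do rewrite VE.
    rewrite sum_normsqrD.
      congr (_ + _); apply: eq_bigr => v _.
      by rewrite !normrM e1 mul1r; case: ifP; rewrite ?normrN normr1 mul1r.
    case: ifP => _; first by under eq_bigr => v _ do rewrite mul1r.
    under eq_bigr => v _ do rewrite mulN1r rmorphN mulrN.
    by rewrite sumrN rmorphN -opprD z0 oppr0.
  under eq_bigr => i _ do rewrite AE.
  rewrite sumr_const card_ord -mulr_natl exprMn sqrtCK.
  by rewrite (_ : 2 ^+ 2 = 4) // -natrX.
have A1i : F <= 4 * A 1 \/ F <= 4 * A 'i.
  have F0 : 0 <= F.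
    apply: sumr_ge0 => v _; by rewrite !addr_ge0 ?mulr_ge0 ?exprn_ge0 ?ler0n.
  (* The squares of 1 and 'i are opposite, so the parallelogram law for al + ga and al - ga gives
     the sum exactly. *)
  have FA : F + F <= 4 * A 1 + 4 * A 'i.
    have -> : 4 * A 1 + 4 * A 'i = F + F + \sum_v 4 * `|be v| ^+ 2.
      rewrite /A /F !mulrDr !mulr_sumr -!big_split /=; apply: eq_bigr => v _.
      rewrite !normCK sqrCi expr1n !(rmorphD, rmorphM, rmorphN, fmorphV) /=.
      rewrite !rmorph1; by field.
    by rewrite lerDl sumr_ge0 // => v _; rewrite mulr_ge0 ?ler0n ?exprn_ge0.
  have r1 : F \is Num.real by exact: ger0_real.
  have r4 e : 4 * A e \is Num.real by rewrite ger0_real // mulr_ge0 ?ler0n.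
  case: (real_leP r1 (r4 1)) => h1; first by left.
  case: (real_leP r1 (r4 'i)) => h2; first by right.
  by have := lt_le_trans (ltrD h1 h2) FA; rewrite ltxx.
rewrite FE; case: A1i => FA.
- by apply: (main 1) => //; rewrite normr1.
- by apply: (main 'i) => //; rewrite normCi.
Qed.

End Congruence.

(** * Concurrence of pure states *)

Section Concurrence.
Variable C : numClosedFieldType.
Implicit Types m n d : nat.

Definition wedge m (M : 'M[C]_(2, m)) a b := M 0 a * M 1 b - M 0 b * M 1 a.

(** The concurrence. On unit vectors it is the negativity ([neg_pureE]); being homogeneous of degree
    2 ([concZ]), it absorbs probabilities into unnormalized vectors. *)
Definition conc m (w : 'cV[C]_(2 * m)) : C :=
  2 * sqrtC (\det (vmat w *m hadj (vmat w))).

Lemma det_mx22 (A : 'M[C]_2) : \det A = A 0 0 * A 1 1 - A 0 1 * A 1 0.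
Proof.
rewrite (expand_det_row _ 0) !big_ord_recl big_ord0 addr0 /cofactor /= !det_mx11.
rewrite !mxE /= expr0 expr1 mul1r mulN1r mulrN.
by congr (A _ _ * A _ _ - A _ _ * A _ _); apply/val_inj.
Qed.

(** Cauchy-Binet; the factor 2 arises because each pair of columns is counted in both orders. *)
Lemma det_gram2 m (M : 'M[C]_(2, m)) :
  2 * \det (M *m hadj M) = \sum_a \sum_b `|wedge M a b| ^+ 2.
Proof.
transitivity (\sum_a \sum_b
   (`|M 0 a| ^+ 2 * `|M 1 b| ^+ 2 + `|M 1 a| ^+ 2 * `|M 0 b| ^+ 2
    - (M 0 a * (M 1 a)^* * (M 1 b * (M 0 b)^*))
    - (M 1 a * (M 0 a)^* * (M 0 b * (M 1 b)^*)))); last first.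
  apply: eq_bigr => a _; apply: eq_bigr => b _.
  rewrite !normCK /wedge !(rmorphB, rmorphM) /=; ring.
have S (F G : 'I_m -> C) :
    \sum_a \sum_b (F a * G b) = (\sum_a F a) * (\sum_b G b).
  by rewrite mulr_suml; apply: eq_bigr => a _; rewrite mulr_sumr.
have E i j : (M *m hadj M) i j = \sum_a M i a * (M j a)^*.
  by rewrite mxE; apply: eq_bigr => a _; rewrite hadjE.
under eq_bigr => a _ do rewrite !(sumrB, big_split) /=.
rewrite !(sumrB, big_split) /= !S det_mx22 !E.
under [X in _ = X * _ + _ - _ - _]eq_bigr => a _ do rewrite normCK.
under [X in _ = _ * X + _ - _ - _]eq_bigr => a _ do rewrite normCK.
under [X in _ = _ + X * _ - _ - _]eq_bigr => a _ do rewrite normCK.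
under [X in _ = _ + _ * X - _ - _]eq_bigr => a _ do rewrite normCK.
ring.
Qed.

Lemma det_gram2_ge0 m (M : 'M[C]_(2, m)) : 0 <= \det (M *m hadj M).
Proof.
rewrite -(@pmulr_rge0 _ 2) ?ltr0n // det_gram2 sumr_ge0 // => a _.
by rewrite sumr_ge0 // => b _; rewrite exprn_ge0.
Qed.

Lemma conc_ge0 m (w : 'cV[C]_(2 * m)) : 0 <= conc w.
Proof. by rewrite mulr_ge0 ?ler0n // sqrtC_ge0 det_gram2_ge0. Qed.

Lemma conc_sqr m (w : 'cV[C]_(2 * m)) :
  conc w ^+ 2 = 2 * \sum_a \sum_b `|wedge (vmat w) a b| ^+ 2.
Proof. by rewrite -det_gram2 exprMn sqrtCK expr2 mulrA. Qed.

Lemma concE m (w : 'cV[C]_(2 * m)) :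
  conc w = sqrtC (2 * \sum_a \sum_b `|wedge (vmat w) a b| ^+ 2).
Proof. by rewrite -conc_sqr sqrCK ?conc_ge0. Qed.

Lemma concZ m (c : C) (w : 'cV[C]_(2 * m)) : conc (c *: w) = `|c| ^+ 2 * conc w.
Proof.
have r0 : 0 <= `|c| ^+ 2 * conc w.
  by apply: mulr_ge0 (conc_ge0 w); rewrite exprn_ge0.
apply/eqP; rewrite -(@eqrXn2 _ 2) ?conc_ge0 //.
rewrite [(_ * conc w) ^+ 2]exprMn !conc_sqr mulrCA; apply/eqP; congr (_ * _).
rewrite mulr_sumr; apply: eq_bigr => a _; rewrite mulr_sumr.
apply: eq_bigr => b _; rewrite -exprMn; congr (_ ^+ 2).
rewrite /wedge !mxE -normrX -normrM; congr `|_|; ring.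
Qed.

Lemma conc22 (w : 'cV[C]_(2 * 2)) : conc w = 2 * `|wedge (vmat w) 0 1|.
Proof.
apply/eqP; rewrite -(@eqrXn2 _ 2) ?conc_ge0 ?mulr_ge0 ?ler0n //.
rewrite conc_sqr !big_ord_recl !big_ord0 (_ : lift 0 0 = 1); last exact/val_inj.
have e0 i : wedge (vmat w) i i = 0 by rewrite /wedge subrr.
have -> : wedge (vmat w) 1 0 = - wedge (vmat w) 0 1 by rewrite /wedge opprB.
rewrite !e0 normr0 normrN expr0n /=; apply/eqP; ring.
Qed.

(** Unnormalized state of the first two systems when the third is measured in the basis of
    conjugated rows of [V], with outcome [k]. In [slice13] the second system is measured. *)
Definition slice12 d (V : 'M[C]_d) (phi : 'cV[C]_(2 * (2 * d))) (k : 'I_d) :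
    'cV[C]_(2 * 2) :=
  \col_a \sum_i V k i * phi (idx3 (tunidx a).1 (tunidx a).2 i) 0.

Definition slice13 d (V : 'M[C]_2) (phi : 'cV[C]_(2 * (2 * d))) (k : 'I_2) :
    'cV[C]_(2 * d) :=
  \col_a \sum_i V k i * phi (idx3 (tunidx a).1 i (tunidx a).2) 0.

Lemma unitary_col n (V : 'M[C]_n) i j : unitary V ->
  \sum_k V k i * (V k j)^* = (i == j)%:R.
Proof.
move=> /mulmx1C/matrixP/(_ j i); rewrite !mxE eq_sym => <-.
by apply: eq_bigr => k _; rewrite hadjE mulrC.
Qed.

Lemma sum_unitary n (V : 'M[C]_n) (f g : 'I_n -> C) : unitary V ->
  \sum_k (\sum_i V k i * f i) * (\sum_i V k i * g i)^* = \sum_i f i * (g i)^*.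
Proof.
move=> uV; transitivity (\sum_k \sum_i \sum_j V k i * f i * (V k j * g j)^*).
  apply: eq_bigr => k _; rewrite mulr_suml; apply: eq_bigr => i _.
  by rewrite rmorph_sum mulr_sumr.
rewrite exchange_big; apply: eq_bigr => i _; rewrite exchange_big /=.
rewrite (bigD1 i) //= [X in _ + X]big1 => [|j ji].
  rewrite addr0 -[RHS]mul1r -[X in X * _](_ : (i == i)%:R = 1); last by rewrite eqxx.
  rewrite -(unitary_col i i uV) mulr_suml; apply: eq_bigr => k _.
  by rewrite rmorphM mulrACA.
rewrite -[RHS](mul0r (f i * (g j)^*)) -[X in X * _](_ : (i == j)%:R = 0); last first.
  by rewrite eq_sym (negPf ji).
rewrite -(unitary_col i j uV) mulr_suml; apply: eq_bigr => k _.
by rewrite rmorphM mulrACA.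
Qed.

(** A partial trace may be computed in any orthonormal basis: [sum_unitary] says that V preserves
    inner products. *)
Lemma red12_slice d (V : 'M[C]_d) (phi : 'cV[C]_(2 * (2 * d))) : unitary V ->
  red12 (phi *m hadj phi) = \sum_k slice12 V phi k *m hadj (slice12 V phi k).
Proof.
move=> uV; apply/matrixP => a b; rewrite !mxE summxE.
transitivity (\sum_i phi (idx3 (tunidx a).1 (tunidx a).2 i) 0
   * (phi (idx3 (tunidx b).1 (tunidx b).2 i) 0)^*).
  by apply: eq_bigr => i _; rewrite mxE big_ord1 hadjE.
rewrite -(sum_unitary _ _ uV); apply: eq_bigr => k _.
by rewrite mxE big_ord1 hadjE !mxE.
Qed.

Lemma red13_slice d (V : 'M[C]_2) (phi : 'cV[C]_(2 * (2 * d))) : unitary V ->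
  red13 (phi *m hadj phi) = \sum_k slice13 V phi k *m hadj (slice13 V phi k).
Proof.
move=> uV; apply/matrixP => a b; rewrite !mxE summxE.
transitivity (\sum_i phi (idx3 (tunidx a).1 i (tunidx a).2) 0
   * (phi (idx3 (tunidx b).1 i (tunidx b).2) 0)^*).
  by apply: eq_bigr => i _; rewrite mxE big_ord1 hadjE.
rewrite -(sum_unitary _ _ uV); apply: eq_bigr => k _.
by rewrite mxE big_ord1 hadjE !mxE.
Qed.

Definition sympart n (T : 'M[C]_n) := 2^-1 *: (T + T^T).

Lemma sympart_sym n (T : 'M[C]_n) : (sympart T)^T = sympart T.
Proof. by rewrite linearZ linearD /= trmxK addrC. Qed.

(** The antisymmetric part of [T] stays antisymmetric under congruence and has zero diagonal. *)
Lemma sympart_diag n (T V : 'M[C]_n) i :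
  (V *m sympart T *m V^T) i i = (V *m T *m V^T) i i.
Proof.
rewrite -scalemxAr -scalemxAl mulmxDr mulmxDl.
have -> : V *m T^T *m V^T = (V *m T *m V^T)^T by rewrite !trmx_mul trmxK mulmxA.
set A := V *m T *m V^T; rewrite [LHS]mxE [X in _ * X]mxE [A^T _ _]mxE.
by field.
Qed.

Lemma congr_outer_diag n (V : 'M[C]_n) (a b : 'cV[C]_n) k :
  (V *m (a *m b^T) *m V^T) k k = (V *m a) k 0 * (V *m b) k 0.
Proof.
by rewrite mulmxA -mulmxA -trmx_mul mxE big_ord1 [(_^T) _ _]mxE.
Qed.

Lemma conc_polygamy_pure d (phi : 'cV[C]_(2 * (2 * d))) :
  exists (V2 : 'M[C]_d) (V3 : 'M[C]_2), [/\ unitary V2, unitary V3 &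
    conc phi <= \sum_k conc (slice12 V2 phi k) + \sum_k conc (slice13 V3 phi k)].
Proof.
pose x (i j : 'I_2) (k : 'I_d) := phi (idx3 i j k) 0.
pose X i j : 'cV[C]_d := \col_k x i j k.
pose Y i k : 'cV[C]_2 := \col_j x i j k.
(* The diagonals of V T V^T and V (U v) V^T list the minors of the slices measured in V. *)
pose T := X 0 0 *m (X 1 1)^T - X 1 0 *m (X 0 1)^T.
pose U (v : 'I_d * 'I_d) := Y 0 v.1 *m (Y 1 v.2)^T - Y 0 v.2 *m (Y 1 v.1)^T.
have [V2 [u2 le2]] := takagi_norm (sympart_sym T).
have [V3 [u3 le3]] := unitary2_norm (fun v => sympart_sym (U v)).
exists V2, V3; split=> //.
set A := \sum_k _; set B := \sum_k _.
have A0 : 0 <= A by rewrite sumr_ge0 // => k _; exact: conc_ge0.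
have B0 : 0 <= B by rewrite sumr_ge0 // => k _; exact: conc_ge0.
pose SS := \sum_i \sum_j `|sympart T i j| ^+ 2.
pose QQ := \sum_v \sum_i \sum_j `|sympart (U v) i j| ^+ 2.
have VX k i j : (V2 *m X i j) k 0 = vmat (slice12 V2 phi k) i j.
  by rewrite !mxE tidxK; apply: eq_bigr => l _; rewrite !mxE.
have VY j i k : (V3 *m Y i k) j 0 = vmat (slice13 V3 phi j) i k.
  by rewrite !mxE tidxK; apply: eq_bigr => l _; rewrite !mxE.
have AE : 4 * SS <= A ^+ 2.
  have -> : A = 2 * \sum_k `|(V2 *m sympart T *m V2^T) k k|.
    rewrite mulr_sumr; apply: eq_bigr => k _; rewrite conc22; congr (_ * `|_|).
    rewrite sympart_diag /T mulmxBr mulmxBl [RHS]mxE [X in _ + X]mxE.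
    rewrite !congr_outer_diag !VX /wedge; ring.
  by rewrite exprMn -natrX ler_wpM2l ?ler0n.
have BE : 2 * QQ <= B ^+ 2.
  have -> : B = sqrtC 2 *
      \sum_k sqrtC (\sum_v `|(V3 *m sympart (U v) *m V3^T) k k| ^+ 2).
    rewrite mulr_sumr; apply: eq_bigr => j _; rewrite concE sqrtCM; first last.
    - rewrite nnegrE; apply: sumr_ge0 => a _; apply: sumr_ge0 => b _.
      exact: exprn_ge0.
    - by rewrite nnegrE ler0n.
    congr (_ * sqrtC _); rewrite pair_bigA; apply: eq_bigr => v _.
    congr (`|_| ^+ 2); rewrite sympart_diag /U mulmxBr mulmxBl [RHS]mxE.
    by rewrite [X in _ + X]mxE !congr_outer_diag !VY.
  by rewrite exprMn sqrtCK ler_wpM2l ?ler0n.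
rewrite -(@ler_pXn2r _ 2) ?nnegrE ?conc_ge0 ?addr_ge0 //.
(* The identity holds for each pair (k, l). With w_ij the minor of columns (i, k) and (j, l), Q has
   diagonal w_00, w_11 and off-diagonal entry (w_01 + w_10)/2, while S_kl = (w_01 - w_10)/2; the
   parallelogram law concludes. *)
have -> : conc phi ^+ 2 = 4 * SS + 2 * QQ.
  rewrite conc_sqr sum_tidx exchange_big /= /QQ.
  rewrite -(pair_bigA _ (fun k l =>
     \sum_i \sum_j `|sympart (U (k, l)) i j| ^+ 2)) /= /SS !mulr_sumr -big_split /=.
  apply: eq_bigr => k _; rewrite !mulr_sumr -big_split /=.
  under eq_bigr => j _ do rewrite sum_tidx exchange_big /= mulr_sumr.
  rewrite exchange_big; apply: eq_bigr => l _ /=.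
  rewrite !big_ord_recl !big_ord0 !addr0 (_ : lift 0 0 = 1); last exact/val_inj.
  rewrite /wedge ![vmat _ _ _]mxE -![phi _ _]/(x _ _ _).
  have TE a b : T a b = x 0 0 a * x 1 1 b - x 1 0 a * x 0 1 b.
    by rewrite !mxE !big_ord1 !mxE.
  have UE a b : U (k, l) a b = x 0 a k * x 1 b l - x 0 a l * x 1 b k.
    by rewrite !mxE !big_ord1 !mxE.
  have SE n (W : 'M[C]_n) a b : sympart W a b = (W a b + W b a) / 2.
    by rewrite !mxE mulrC.
  rewrite !SE !TE !UE !normCK !(rmorphB, rmorphD, rmorphM, fmorphV) /= !rmorph1.
  by field.
apply: le_trans (lerD AE BE) _; rewrite sqrrD -addrA lerD2l lerDr.
by rewrite mulrn_wge0 ?mulr_ge0.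
Qed.

End Concurrence.

(** * Negativity of assistance *)

Section NormSqr.
Variable C : numClosedFieldType.
Implicit Types m n d : nat.

Definition normsq n (w : 'cV[C]_n) : C := \sum_a `|w a 0| ^+ 2.

Lemma normsq_ge0 n (w : 'cV[C]_n) : 0 <= normsq w.
Proof. by rewrite sumr_ge0 // => a _; rewrite exprn_ge0. Qed.

Lemma hadj_mul_normsq n (w : 'cV[C]_n) : hadj w *m w = (normsq w)%:M.
Proof.
apply/matrixP => i j; rewrite !ord1 !mxE eqxx mulr1n.
by apply: eq_bigr => a _; rewrite hadjE normCK mulrC.
Qed.

Lemma trace_outer n (w : 'cV[C]_n) : \tr (w *m hadj w) = normsq w.
Proof. by rewrite mxtrace_mulC hadj_mul_normsq mxtrace_scalar. Qed.

Lemma trace_vmat m n (w : 'cV[C]_(m * n)) :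
  \tr (vmat w *m hadj (vmat w)) = normsq w.
Proof.
rewrite mxtrace_gram /normsq sum_tidx; apply: eq_bigr => i _.
by apply: eq_bigr => j _; rewrite mxE.
Qed.

(** The discriminant (tr G)^2 - 4 det G of a Hermitian 2 x 2 matrix is a sum of squares. *)
Lemma conc_le_normsq m (w : 'cV[C]_(2 * m)) : conc w <= normsq w.
Proof.
rewrite -(@ler_pXn2r _ 2) ?nnegrE ?conc_ge0 ?normsq_ge0 // conc_sqr -det_gram2.
set M := vmat w; set G := M *m hadj M.
have -> : normsq w = G 0 0 + G 1 1.
  rewrite -trace_vmat /mxtrace !big_ord_recl big_ord0 addr0.
  by rewrite (_ : lift 0 0 = 1) //; exact/val_inj.
have hG i j : (G i j)^* = G j i by rewrite -hadjE /G hadjM hadjK.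
rewrite det_mx22 -(hG 0 1) -normCK -subr_ge0.
have -> : (G 0 0 + G 1 1) ^+ 2
    - 2 * (2 * (G 0 0 * G 1 1 - `|G 0 1| ^+ 2))
  = (G 0 0 - G 1 1) ^+ 2 + 4 * `|G 0 1| ^+ 2 by ring.
apply: addr_ge0; last by rewrite mulr_ge0 ?ler0n ?exprn_ge0.
by rewrite -realEsqr rpredB //; apply/CrealP; rewrite hG.
Qed.

Lemma normalize_vector m (w : 'cV[C]_(2 * m)) : (0 < m)%N ->
  exists phi : 'cV[C]_(2 * m), [/\ hadj phi *m phi = 1%:M,
    w *m hadj w = normsq w *: (phi *m hadj phi) &
    conc w = normsq w * conc phi].
Proof.
move=> m0; have [w0|w0] := eqVneq (normsq w) 0.
  have a0 : (0 < 2 * m)%N by rewrite muln_gt0.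
  (* A zero vector gets weight 0, so any unit vector can stand for it. *)
  exists (delta_mx (Ordinal a0) 0); split.
  - apply/matrixP => i j; rewrite !ord1 !mxE (bigD1 (Ordinal a0)) //=.
    rewrite big1 ?addr0 => [|a aa]; first by rewrite !mxE !eqxx conjC_nat mulr1.
    by rewrite !mxE (negPf aa) /= mulr0.
  - rewrite w0 scale0r.
    suff -> : w = 0 by rewrite mul0mx.
    apply/matrixP => i j; rewrite ord1 mxE; apply/eqP.
    rewrite -normr_eq0 -sqrf_eq0.
    by have /psumr_eq0P -> := w0 => // k _; rewrite exprn_ge0.
  - apply/eqP; rewrite w0 mul0r eq_le conc_ge0 andbT -w0; exact: conc_le_normsq.
have s0 : sqrtC (normsq w) != 0 by rewrite sqrtC_eq0.
have sr : (sqrtC (normsq w))^* = sqrtC (normsq w).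
  by apply/CrealP; rewrite ger0_real // sqrtC_ge0 normsq_ge0.
have nZ c n (v : 'cV[C]_n) : hadj (c *: v) = c^* *: hadj v.
  by apply/matrixP => i j; rewrite !mxE rmorphM.
exists ((sqrtC (normsq w))^-1 *: w); split.
- rewrite nZ -scalemxAl -scalemxAr scalerA hadj_mul_normsq fmorphV /= sr.
  by rewrite -expr2 exprVn sqrtCK -[LHS]scale1r scalerA mul1r scale_scalar_mx mulVf.
- rewrite nZ -scalemxAl -scalemxAr !scalerA fmorphV /= sr.
  by rewrite -mulrA -expr2 exprVn sqrtCK mulfV // scale1r.
- rewrite concZ mulrA normfV exprVn ger0_norm ?sqrtC_ge0 ?normsq_ge0 //.
  by rewrite sqrtCK mulfV // mul1r.
Qed.

End NormSqr.

(** * Ensembles and subadditivity of the negativity of assistance *)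

Section Assistance.
Variable R : realType.
Implicit Types m n d : nat.
Local Notation C := R[i].
Local Notation "x %:C" := (real_complex R x).

Lemma neg_pureE m (phi : 'cV[C]_(2 * m)) : hadj phi *m phi = 1%:M ->
  (neg_pure phi)%:C = conc phi.
Proof.
rewrite hadj_mul_normsq => /matrixP/(_ 0 0); rewrite !mxE !mulr1n => n1.
rewrite /neg_pure tracenorm_pure2 trace_vmat n1 -/(conc phi).
rewrite rmorphB rmorph1 /= RRe_real ?rpredD ?rpred1 ?ger0_real ?conc_ge0 //.
by rewrite addrC addKr.
Qed.

(** The upper bound makes [sup] a genuine least upper bound. *)
Lemma ensemble_neg_itv m (rho : 'M[C]_(2 * m)) x :
  ensemble_neg rho x -> 0 <= x <= 1.
Proof.
move=> [K [p [phi [p0 p1 nphi _ ->]]]].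
have h j : 0 <= neg_pure (phi j) <= 1.
  rewrite -!lecR neg_pureE // conc_ge0 /=; apply: le_trans (conc_le_normsq _) _.
  have := nphi j; rewrite hadj_mul_normsq => /matrixP/(_ 0 0).
  by rewrite !mxE !mulr1n => ->.
rewrite sumr_ge0 /=; last first.
  by move=> j _; rewrite mulr_ge0 //; case/andP: (h j).
rewrite -p1 ler_sum // => j _; rewrite -[leRHS]mulr1 ler_wpM2l //.
by case/andP: (h j).
Qed.

Lemma ensemble_neg_le m (rho : 'M[C]_(2 * m)) x :
  ensemble_neg rho x -> x <= neg_assist rho.
Proof.
move=> Ex; apply: ub_le_sup Ex; exists 1 => y.
by case/ensemble_neg_itv/andP.
Qed.

Lemma neg_assist_ge0 m (rho : 'M[C]_(2 * m)) : 0 <= neg_assist rho.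
Proof.
rewrite /neg_assist; set E := [set x | _]%classic.
have [->|/set0P[x Ex]] := eqVneq E set0; first by rewrite sup0.
have /andP[x0 _] := ensemble_neg_itv Ex; apply: le_trans x0 _.
exact: ensemble_neg_le.
Qed.

(* The hypothesis 0 <= b is for the case of an empty set of ensembles, whose
   supremum is 0. *)
Lemma neg_assist_le m (rho : 'M[C]_(2 * m)) b : 0 <= b ->
  (forall x, ensemble_neg rho x -> x <= b) -> neg_assist rho <= b.
Proof.
move=> b0 hb; rewrite /neg_assist; set E := [set x | _]%classic.
have [->|/set0P E0] := eqVneq E set0; first by rewrite sup0.
by apply: ge_sup.
Qed.

(** Each vector is normalized and its squared norm becomes its probability; [enum_val] passes to the
    ordinal indices of [ensemble_neg]. *)
Lemma unnormalized_ensemble (I : finType) m (w : I -> 'cV[C]_(2 * m)) :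
  (0 < m)%N -> \sum_i normsq (w i) = 1 ->
  \sum_i conc (w i) <= (neg_assist (\sum_i w i *m hadj (w i)))%:C.
Proof.
move=> m0 w1; have /fin_all_exists[phi hphi] := fun i => normalize_vector (w i) m0.
have nR i : (complex.Re (normsq (w i)))%:C = normsq (w i).
  by rewrite RRe_real // ger0_real ?normsq_ge0.
have reidx (V : nmodType) (F : I -> V) :
    \sum_i F i = \sum_(j < #|I|) F (enum_val j).
  by rewrite (reindex (@enum_val I I)) //=; exact/onW_bij/enum_val_bij.
pose x := \sum_i complex.Re (normsq (w i)) * neg_pure (phi i).
have xE : x%:C = \sum_i conc (w i).
  rewrite rmorph_sum; apply: eq_bigr => i _ /=.
  by have [n1 _ ->] := hphi i; rewrite rmorphM /= nR neg_pureE.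
rewrite -xE lecR; apply: ensemble_neg_le.
exists #|I|, (fun j => complex.Re (normsq (w (enum_val j)))).
exists (fun j => phi (enum_val j)); split.
- by move=> j; rewrite -ler0c nR normsq_ge0.
- apply: complexI; rewrite rmorph_sum rmorph1 -w1 reidx.
  by apply: eq_bigr => j _; exact: nR.
- by move=> j; case: (hphi (enum_val j)).
- rewrite reidx; apply: eq_bigr => j _; rewrite nR.
  by case: (hphi (enum_val j)).
- exact: reidx.
Qed.

(** The root of [p j] is absorbed into the vectors, giving one family indexed by pairs. *)
Lemma mixture_le K d m (p : 'I_K -> R) (w : 'I_K -> 'I_d -> 'cV[C]_(2 * m)) rho :
  (0 < m)%N -> (forall j, 0 <= p j) -> \tr rho = 1 ->
  rho = \sum_j (p j)%:C *: \sum_k w j k *m hadj (w j k) ->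
  \sum_j (p j)%:C * \sum_k conc (w j k) <= (neg_assist rho)%:C.
Proof.
move=> m0 p0 tr1 rhoE.
pose v (jk : 'I_K * 'I_d) := sqrtC (p jk.1)%:C *: w jk.1 jk.2.
have sp j : `|sqrtC (p j)%:C| ^+ 2 = (p j)%:C.
  by rewrite ger0_norm ?sqrtCK // sqrtC_ge0 ler0c.
have vE : rho = \sum_jk v jk *m hadj (v jk).
  rewrite rhoE -(pair_bigA _ (fun j k => v (j, k) *m hadj (v (j, k)))) /=.
  apply: eq_bigr => j _; rewrite scaler_sumr; apply: eq_bigr => k _.
  apply/matrixP => a b; rewrite /v !mxE !big_ord1 !mxE rmorphM /= -[X in X * _ = _]sp normCK.
  ring.
have -> : \sum_j (p j)%:C * \sum_k conc (w j k) = \sum_jk conc (v jk).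
  rewrite -(pair_bigA _ (fun j k => conc (v (j, k)))) /=.
  apply: eq_bigr => j _; rewrite mulr_sumr; apply: eq_bigr => k _.
  by rewrite concZ sp.
rewrite vE; apply: unnormalized_ensemble => //.
rewrite -tr1 vE linear_sum; apply: eq_bigr => jk _; exact/esym/trace_outer.
Qed.

Lemma trace_red12 d (rho : 'M[C]_(2 * (2 * d))) : \tr (red12 rho) = \tr rho.
Proof.
rewrite /mxtrace !sum_tidx; apply: eq_bigr => i _; rewrite sum_tidx.
by apply: eq_bigr => j _; rewrite mxE tidxK.
Qed.

Lemma trace_red13 d (rho : 'M[C]_(2 * (2 * d))) : \tr (red13 rho) = \tr rho.
Proof.
rewrite /mxtrace !sum_tidx; apply: eq_bigr => i _; rewrite sum_tidx exchange_big.
by apply: eq_bigr => j _; rewrite mxE tidxK.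
Qed.

Lemma red12_sum d K (c : 'I_K -> C) (A : 'I_K -> 'M[C]_(2 * (2 * d))) :
  red12 (\sum_j c j *: A j) = \sum_j c j *: red12 (A j).
Proof.
apply/matrixP => a b; rewrite mxE summxE.
under eq_bigr => i _ do rewrite summxE.
rewrite exchange_big; apply: eq_bigr => j _ /=; rewrite !mxE mulr_sumr.
by apply: eq_bigr => i _; rewrite mxE.
Qed.

Lemma red13_sum d K (c : 'I_K -> C) (A : 'I_K -> 'M[C]_(2 * (2 * d))) :
  red13 (\sum_j c j *: A j) = \sum_j c j *: red13 (A j).
Proof.
apply/matrixP => a b; rewrite mxE summxE.
under eq_bigr => i _ do rewrite summxE.
rewrite exchange_big; apply: eq_bigr => j _ /=; rewrite !mxE mulr_sumr.
by apply: eq_bigr => i _; rewrite mxE.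
Qed.

(** Every member of an ensemble of [rho] is measured in its own bases from [conc_polygamy_pure]; the
    slices, mixed over the ensemble, decompose both reduced states. *)
Lemma neg_assist_polygamy d (rho : 'M[C]_(2 * (2 * d))) :
  (0 < d)%N -> \tr rho = 1 ->
  neg_assist rho <= neg_assist (red12 rho) + neg_assist (red13 rho).
Proof.
move=> d0 tr1; apply: neg_assist_le; first by rewrite addr_ge0 ?neg_assist_ge0.
move=> x [K [p [phi [p0 p1 nphi rhoE ->]]]].
have /fin_all_exists[V2 /fin_all_exists[V3 hV]] :=
  fun j => conc_polygamy_pure (phi j).
rewrite -lecR rmorphD rmorph_sum /=.
apply: le_trans (_ : \sum_j (p j)%:C *
   (\sum_k conc (slice12 (V2 j) (phi j) k)
    + \sum_k conc (slice13 (V3 j) (phi j) k)) <= _).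
  apply: ler_sum => j _; rewrite rmorphM /= neg_pureE // ler_wpM2l ?ler0c //.
  by case: (hV j).
under eq_bigr => j _ do rewrite mulrDr.
rewrite big_split /=; apply: lerD; apply: mixture_le => //.
- by rewrite trace_red12.
- rewrite rhoE red12_sum; apply: eq_bigr => j _; congr (_ *: _).
  by apply: red12_slice; case: (hV j).
- by rewrite trace_red13.
- rewrite rhoE red13_sum; apply: eq_bigr => j _; congr (_ *: _).
  by apply: red13_slice; case: (hV j).
Qed.

End Assistance.

(** * Power inequalities *)

Section PowerInequalities.
Variable R : realType.
Implicit Types (t s : R).

Lemma powR_conv t (l a b : R) : 1 <= t -> 0 <= l <= 1 -> 0 <= a -> 0 <= b ->
  (l * a + (1 - l) * b) `^ t <= l * a `^ t + (1 - l) * b `^ t.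
Proof.
move=> t1 /andP[l0 l1] a0 b0.
have := @convex_powR R t t1 (Itv01 l0 l1) a b.
rewrite !inE /= !in_itv /= !andbT => /(_ a0 b0).
by rewrite !convRE.
Qed.

(** The points u and v are convex combinations of m and M with exchanged weights; adding the two
    convexity inequalities cancels the weights. If m = M the weight [l] would divide by 0, but all
    four numbers agree. *)
Lemma powR_majorize t (m u v M : R) : 1 <= t -> 0 <= m -> m <= u -> m <= v ->
  u + v = m + M -> u `^ t + v `^ t <= m `^ t + M `^ t.
Proof.
move=> t1 m0 mu mv uvE.
have [mM|mM] := eqVneq m M.
  have -> : u = m by lra.
  have -> : v = M by lra.
  exact: lexx.
have lt_mM : m < M by rewrite lt_neqAle mM; lra.
pose l := (M - u) / (M - m).
have d0 : M - m != 0 by rewrite subr_eq0 eq_sym.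
have l01 : 0 <= l <= 1.
  by rewrite /l divr_ge0 ?ler_pdivrMr //; lra.
have hu := powR_conv t1 l01 m0 (ltW (le_lt_trans m0 lt_mM)).
have l01' : 0 <= 1 - l <= 1 by lra.
have hv := powR_conv t1 l01' m0 (ltW (le_lt_trans m0 lt_mM)).
have uE : u = l * m + (1 - l) * M by rewrite /l; field.
have vE : v = (1 - l) * m + (1 - (1 - l)) * M.
  have -> : v = m + M - u by lra.
  by rewrite /l; field.
rewrite -uE in hu; rewrite -vE in hv; nra.
Qed.

(** Superadditivity of the power 1/s, applied to the s-th powers of a and b. *)
Lemma powR_subadd s (a b : R) : 0 < s <= 1 -> 0 <= a -> 0 <= b ->
  (a + b) `^ s <= a `^ s + b `^ s.
Proof.
move=> /andP[s0 s1] a0 b0.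
have si : 1 <= s^-1 by rewrite invf_ge1.
have K (c : R) : 0 <= c -> (c `^ s) `^ s^-1 = c.
  by move=> c0; rewrite -powRrM mulfV ?gt_eqF // powRr1.
have A0 := powR_ge0 a s; have B0 := powR_ge0 b s.
have := @powR_majorize s^-1 0 (a `^ s) (b `^ s) (a `^ s + b `^ s) si (lexx 0) A0 B0.
rewrite add0r => /(_ erefl); rewrite !K // powR0 ?gt_eqF ?invr_gt0 // add0r => h.
have := ge0_ler_powR (ltW s0) _ _ h.
rewrite !nnegrE addr_ge0 // powR_ge0 => /(_ isT isT) /le_trans; apply.
by rewrite -powRrM mulVf ?gt_eqF // powRr1 // addr_ge0.
Qed.

Lemma powR_weighted t (k q X Y : R) : 1 <= t -> 1 <= k -> 0 < q <= 1 ->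
  0 <= X -> k * X <= Y ->
  (X + Y) `^ t <= q `^ t * X `^ t + ((1 + k) `^ t - q `^ t) / k `^ t * Y `^ t.
Proof.
move=> t1 k1 /andP[q0 q1] X0 kXY.
have k0 : 0 < k by lra.
have t0 : 0 < t by lra.
have kt0 : 0 < k `^ t by rewrite powR_gt0.
have qt1 : q `^ t <= 1.
  by have := @ge0_ler_powR _ t (ltW t0) q 1; rewrite !nnegrE ler01 ltW // powR1; apply.
have kX0 : 0 <= k * X by rewrite mulr_ge0 // ltW.
have Y0 : 0 <= Y by exact: le_trans kXY.
have Z0 : 0 <= Y / k by rewrite divr_ge0 // ltW.
have XZ : X <= Y / k by rewrite ler_pdivlMr // mulrC.
have YE : Y = k * (Y / k) by rewrite mulrC divfK // gt_eqF.
have -> : ((1 + k) `^ t - q `^ t) / k `^ t * Y `^ t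
    = ((1 + k) `^ t - q `^ t) * (Y / k) `^ t.
  by rewrite [in LHS]YE powRM ?(ltW k0) // mulrA divfK // gt_eqF.
set Z := Y / k in Z0 XZ YE *.
rewrite mulrBl -(@powRM _ (1 + k) Z) //; last by lra.
(* With Z = Y / k, this bounds (X + Y)^t by X^t - Z^t + ((1 + k) Z)^t. The claimed bound exceeds
   that by (1 - q^t)(Z^t - X^t), which is nonnegative. *)
have m := @powR_majorize t X Z (X + Y) (Z + Y) t1 X0 XZ.
have := m _ _; rewrite (_ : X <= X + Y); last by lra.
move=> /(_ isT (ltac:(lra))) h.
rewrite (_ : (1 + k) * Z = Z + Y); last by rewrite YE; ring.
have : X `^ t <= Z `^ t by apply: ge0_ler_powR; rewrite ?nnegrE // ltW.
have := powR_ge0 q t; nra.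
Qed.

(** Apply [powR_weighted] with t = beta / s to X = a^s and Y = b^s; [powR_subadd] turns N <= a + b
    into N^s <= X + Y. *)
Lemma powR_polygamy (s beta k q N a b : R) :
  1 <= k -> 0 < q <= 1 -> 0 < s <= 1 -> s <= beta ->
  0 <= N -> 0 <= a -> 0 <= b -> N <= a + b -> k * a `^ s <= b `^ s ->
  N `^ beta <= q `^ (beta / s) * a `^ beta
     + ((1 + k) `^ (beta / s) - q `^ (beta / s)) / k `^ (beta / s) * b `^ beta.
Proof.
move=> k1 q01 s01 sb N0 a0 b0 Nab kab; have /andP[s0 s1] := s01.
have t1 : 1 <= beta / s by rewrite ler_pdivlMr // mul1r.
have E (c : R) : c `^ beta = (c `^ s) `^ (beta / s).
  by rewrite -powRrM mulrC divfK // gt_eqF.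
rewrite !(E N) !(E a) !(E b).
apply: le_trans (powR_weighted t1 k1 q01 (powR_ge0 _ _) kab).
apply: ge0_ler_powR; rewrite ?nnegrE ?addr_ge0 ?powR_ge0 //; first lra.
apply: le_trans (powR_subadd s01 a0 b0).
by apply: ge0_ler_powR; rewrite ?nnegrE ?addr_ge0 // ltW.
Qed.

End PowerInequalities.

Theorem theorem4 (R : realType) (n : nat)
  (rho : 'M[R[i]]_(2 * (2 * 2 ^ (n - 2)))) (k q s beta : R) :
  (3 <= n)%N -> is_state rho ->
  1 <= k -> 0 < q <= 1 -> 0 < s <= 1 -> s <= beta ->
  (neg_assist (@red13 _ 2 2 (2 ^ (n - 2)) rho) `^ s
       >= k * neg_assist (@red12 _ 2 2 (2 ^ (n - 2)) rho) `^ s ->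
   neg_assist rho `^ beta
     <= q `^ (beta / s) * neg_assist (@red12 _ 2 2 (2 ^ (n - 2)) rho) `^ beta
        + ((1 + k) `^ (beta / s) - q `^ (beta / s)) / k `^ (beta / s)
          * neg_assist (@red13 _ 2 2 (2 ^ (n - 2)) rho) `^ beta)
  /\
  (neg_assist (@red12 _ 2 2 (2 ^ (n - 2)) rho) `^ s
       >= k * neg_assist (@red13 _ 2 2 (2 ^ (n - 2)) rho) `^ s ->
   neg_assist rho `^ beta
     <= q `^ (beta / s) * neg_assist (@red13 _ 2 2 (2 ^ (n - 2)) rho) `^ beta
        + ((1 + k) `^ (beta / s) - q `^ (beta / s)) / k `^ (beta / s)
          * neg_assist (@red12 _ 2 2 (2 ^ (n - 2)) rho) `^ beta).
Proof.
move=> _ [_ _ tr1] k1 q01 s01 sb.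
have N_le := neg_assist_polygamy (expn_gt0 2 (n - 2)) tr1.
split=> hk; apply: powR_polygamy; rewrite ?neg_assist_ge0 //.
by rewrite addrC.
Qed.
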